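(* Let $F$ be a field and let $A\in\mathrm{GL}_n(F)$. Then there exists a reordering of the rows of $A$ such that no two consecutive rows are null-connected. In particular, the two-row graph $\mathcal{G}(A)$ of $A$ always contains a Hamiltonian path.
   Context: Let $A$ be a matrix with $n$ columns over a field $F$, with rows $r_1,r_2,\ldots$, and write $r_i^k$ for the entry of row $r_i$ in column $k$. Two rows $r_i$ and $r_j$ of $A$ are null-connected if for every $1\leq k<n$ the matrix $\begin{pmatrix} r_i^k & r_i^{k+1}\\ r_j^k & r_j^{k+1}\end{pmatrix}$ is singular. The two-row graph $\mathcal{G}(A)$ is the undirected graph whose vertices are the rows of $A$, in which rows $r_i$ and $r_j$ are joined by an edge if and only if for some $1\leq k<n$ the matrix $\begin{pmatrix} r_i^k & r_i^{k+1}\\ r_j^k & r_j^{k+1}\end{pmatrix}$ is invertible (i.e. if and only if they are not null-connected). A Hamiltonian path is a path visiting every vertex exactly once. *)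

(* Defs.v *)
From mathcomp Require Import all_boot all_order all_fingroup all_algebra.

Set Implicit Arguments.
Unset Strict Implicit.
Unset Printing Implicit Defensive.

Import GRing.Theory.
Local Open Scope ring_scope.

Definition two_row_minor (F : fieldType) (n : nat) (r s : 'rV[F]_n)
    (k k' : 'I_n) : 'M[F]_2 :=
  \matrix_(a < 2, b < 2)
    (if a == 0 then r else s) 0 (if b == 0 then k else k').

(* Consecutive columns k, k+1 are a pair of ordinals (k, k') with k' = k + 1;
   columns are numbered from 0. *)
Definition null_connected (F : fieldType) (n : nat) (r s : 'rV[F]_n) : bool :=
  [forall k : 'I_n, forall k' : 'I_n,
     (k' == k.+1 :> nat) ==> (two_row_minor r s k k' \notin unitmx)].

(* The vertices are the row indices, so equal rows at different positions
   are distinct vertices. *)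
Definition two_row_graph (F : fieldType) (m n : nat) (A : 'M[F]_(m, n)) :
    rel 'I_m :=
  fun i j => [exists k : 'I_n, exists k' : 'I_n,
     (k' == k.+1 :> nat) && (two_row_minor (row i A) (row j A) k k' \in unitmx)].

(* On an empty vertex set the empty sequence counts as a Hamiltonian path. *)
Definition hamiltonian_path (T : finType) (e : rel T) (p : seq T) : bool :=
  [&& sorted e p, uniq p & [forall x, x \in p]].

Lemma two_row_graphE (F : fieldType) (m n : nat) (A : 'M[F]_(m, n)) i j :
  two_row_graph A i j = ~~ null_connected (row i A) (row j A).
Proof.
rewrite /two_row_graph /null_connected negb_forall.
apply: eq_existsb => k; rewrite negb_forall.
by apply: eq_existsb => k'; rewrite negb_imply negbK.
Qed.

Lemma two_row_minorE (F : fieldType) (n : nat) (r s : 'rV[F]_n) k k' :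
  \det (two_row_minor r s k k') = r 0 k * s 0 k' - r 0 k' * s 0 k.
Proof.
rewrite (expand_det_row _ ord0) 2!big_ord_recl big_ord0 addr0 !mxE /=.
rewrite /cofactor !det_mx11 !mxE /= expr0 expr1 mul1r mulN1r.
by rewrite mulrN.
Qed.

Lemma two_row_graph_sym (F : fieldType) (m n : nat) (A : 'M[F]_(m, n)) :
  symmetric (two_row_graph A).
Proof.
move=> i j; apply: eq_existsb => k; apply: eq_existsb => k'.
rewrite !unitmxE !two_row_minorE -[in RHS]unitrN opprB.
by rewrite [_ * row i A 0 k]mulrC [_ * row i A 0 k']mulrC.
Qed.

Lemma two_row_graph_irr (F : fieldType) (m n : nat) (A : 'M[F]_(m, n)) :
  irreflexive (two_row_graph A).
Proof.
move=> i; apply/existsP=> -[k /existsP[k' /andP[_]]].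
by rewrite unitmxE two_row_minorE [X in _ - X]mulrC subrr unitr0.
Qed.

(* Main.v *)
Require Import Defs.
From mathcomp Require Import all_boot all_order all_fingroup all_algebra.

Set Implicit Arguments.
Unset Strict Implicit.
Unset Printing Implicit Defensive.

Import GRing.Theory.
Local Open Scope ring_scope.

(** The graph only shrinks if a row is cut at a zero entry [c] into its part to
    the left of [c] and its part to the right of [c]: on any two consecutive
    columns such a part either agrees with the row or vanishes.  On the other
    hand the determinant is additive in each row, so one of the two parts keeps
    the matrix invertible.  Cutting as long as possible yields an invertible
    matrix [B], with no more edges than [A], in which the support of each row is
    an interval of columns ([exists_gapless]).

    For such a [B] the Leibniz formula provides the ordering: order the rows so
    that the diagonal has no zero.  If the rows [x], [y] in positions [k], [k+1]
    were null-connected, then [x_k y_(k+1) = x_(k+1) y_k] would be nonzero, so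
    both intervals contain [k] and [k+1], and the vanishing minors propagate the
    ratio [y_k / x_k] along the interval in both directions.  Then [x] and [y]
    would be proportional ([gapless_proportional]), which independence of the
    rows of [B] forbids. *)

(** * Null-connected rows *)

Lemma null_connectedP (F : fieldType) (n : nat) (r s : 'rV[F]_n) :
  reflect (forall k k' : 'I_n, k' = k.+1 :> nat ->
             r 0 k * s 0 k' = r 0 k' * s 0 k)
          (null_connected r s).
Proof.
apply: (iffP forallP) => [nc k k' /eqP kk'|nc k].
  have /forallP/(_ k')/implyP/(_ kk') := nc k.
  by rewrite unitmxE two_row_minorE unitfE negbK subr_eq0 => /eqP.
apply/forallP => k'; apply/implyP => /eqP kk'.
by rewrite unitmxE two_row_minorE unitfE negbK subr_eq0 nc.
Qed.

Lemma null_connected_refl (F : fieldType) (n : nat) (r : 'rV[F]_n) :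
  null_connected r r.
Proof. by apply/null_connectedP => k k' _; rewrite mulrC. Qed.

Lemma null_connected_sym (F : fieldType) (n : nat) :
  symmetric (@null_connected F n).
Proof.
move=> r s; apply/null_connectedP/null_connectedP => nc k k' /nc e;
  by rewrite mulrC -e mulrC.
Qed.

(** * Cutting rows at zero entries *)

Definition restrict_row (F : fieldType) (m n : nat) (D : pred 'I_n) (i0 : 'I_m)
    (A : 'M[F]_(m, n)) : 'M[F]_(m, n) :=
  \matrix_(i, j) if (i != i0) || D j then A i j else 0.

Lemma det_restrict_row (F : fieldType) (n : nat) (D : pred 'I_n) (i0 : 'I_n)
    (A : 'M[F]_n) :
  \det A = \det (restrict_row D i0 A) + \det (restrict_row (predC D) i0 A).
Proof.
rewrite -[X in X + _]mul1r -[X in _ + X]mul1r.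
apply: (determinant_multilinear (i0 := i0)).
- apply/rowP => j; rewrite !mxE eqxx /= !mul1r.
  by case: (D j); rewrite /= ?addr0 ?add0r.
- by apply/matrixP => i j; rewrite !mxE eq_sym neq_lift.
- by apply/matrixP => i j; rewrite !mxE eq_sym neq_lift.
Qed.

(** The hypothesis says that [D] changes, from left to right, only on entering a
    column where row [i0] is zero: on two consecutive columns the restricted row
    then agrees with the original one or is zero. *)
Lemma null_connected_restrict_row (F : fieldType) (m n : nat) (D : pred 'I_n)
    (i0 : 'I_m) (A : 'M[F]_(m, n)) :
    (forall k k' : 'I_n, k' = k.+1 :> nat -> D k != D k' -> A i0 k' = 0) ->
  forall i j, null_connected (row i A) (row j A) ->
    null_connected (row i (restrict_row D i0 A)) (row j (restrict_row D i0 A)).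
Proof.
move=> cutD.
have rowN i : i != i0 -> row i (restrict_row D i0 A) = row i A.
  by move=> ne; apply/rowP => j; rewrite !mxE ne.
have nc0 i : i != i0 -> null_connected (row i0 A) (row i A) ->
    null_connected (row i0 (restrict_row D i0 A)) (row i A).
  move=> ne /null_connectedP nc; apply/null_connectedP => k k' kk'.
  have := nc k k' kk'; rewrite !mxE eqxx /=.
  have := cutD k k' kk'.
  by case: (D k) (D k') => [] [] //= => [/(_ isT) -> | /(_ isT) -> | _ _];
    rewrite ?mul0r.
move=> i j; have [-> | nei] := eqVneq i i0; have [-> | nej] := eqVneq j i0.
- by move=> _; apply: null_connected_refl.
- by rewrite (rowN _ nej); apply: nc0.
- by rewrite (rowN _ nei) !(null_connected_sym (row i A)); apply: nc0.
- by rewrite !rowN.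
Qed.

Definition gapless (F : fieldType) (n : nat) (r : 'rV[F]_n) : Prop :=
  forall a c b : 'I_n, (a < c)%N -> (c < b)%N ->
    r 0 c = 0 -> r 0 a = 0 \/ r 0 b = 0.

Definition nnz (F : fieldType) (m n : nat) (A : 'M[F]_(m, n)) : nat :=
  #|[set ij : 'I_m * 'I_n | A ij.1 ij.2 != 0]|.

Lemma nnz_restrict_row (F : fieldType) (m n : nat) (D : pred 'I_n) (i0 : 'I_m)
    (j0 : 'I_n) (A : 'M[F]_(m, n)) :
  ~~ D j0 -> A i0 j0 != 0 -> (nnz (restrict_row D i0 A) < nnz A)%N.
Proof.
move=> nD nz; apply/proper_card/properP; split.
  apply/subsetP => -[i j]; rewrite !inE /= mxE.
  by case: ifP => // _; rewrite eqxx.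
by exists (i0, j0); rewrite !inE //= mxE eqxx (negbTE nD) eqxx.
Qed.

(** Induction on the number of nonzero entries: a zero at [c] with nonzero entries
    on both sides makes both parts of the row strictly sparser than the row. *)
Lemma exists_gapless (F : fieldType) (n : nat) (A : 'M[F]_n) :
    A \in unitmx ->
  exists B : 'M[F]_n, [/\ B \in unitmx, forall i, gapless (row i B)
    & forall i j, null_connected (row i A) (row j A) ->
                  null_connected (row i B) (row j B)].
Proof.
have [N] := ubnP (nnz A); elim: N A => // N IH A ltAN uA.
pose gap (q : 'I_n * ('I_n * ('I_n * 'I_n))) :=
  let: (i, (a, (c, b))) := q in
  [&& (a < c)%N, (c < b)%N, A i c == 0, A i a != 0 & A i b != 0].
have [[i [a [c b]]] /and5P[ac cb /eqP Ac0 Aa Ab] | nogap] := pickP gap; last first.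
  exists A; split=> // i a c b ac cb; rewrite !mxE => Ac0.
  have := nogap (i, (a, (c, b))); rewrite /gap ac cb Ac0 eqxx /=.
  by case: eqP => [|_]; [left | case: eqP => //; right].
(* Restricting row i to D loses the nonzero entry in column j0. *)
have step D j0 : ~~ D j0 -> A i j0 != 0 ->
    (forall k k' : 'I_n, k' = k.+1 :> nat -> D k != D k' -> A i k' = 0) ->
    \det (restrict_row D i A) != 0 ->
  exists B : 'M[F]_n, [/\ B \in unitmx, forall i, gapless (row i B)
    & forall i j, null_connected (row i A) (row j A) ->
                  null_connected (row i B) (row j B)].
  move=> nD nz cutD dD.
  have [||B [uB gB ncB]] := IH (restrict_row D i A).
  - exact: leq_trans (nnz_restrict_row nD nz) ltAN.
  - by rewrite unitmxE unitfE.
  exists B; split=> // i1 i2 nc; apply: ncB.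
  exact: null_connected_restrict_row.
pose D : pred 'I_n := fun j => (j < c)%N.
have cutD (k k' : 'I_n) : k' = k.+1 :> nat -> D k != D k' -> A i k' = 0.
  rewrite /D => kk' neD; suff -> : k' = c by [].
  apply/val_inj => /=; move: neD; rewrite kk' [(k < c)%N]leq_eqVlt.
  by case: (k.+1 =P c :> nat) => //= _; rewrite eqxx.
have : \det A != 0 by rewrite -unitfE -unitmxE.
rewrite (det_restrict_row D i).
have [-> | dD _] := eqVneq (\det (restrict_row D i A)) 0; last first.
  by apply: (step D b) => //; rewrite /D -leqNgt ltnW.
rewrite add0r; apply: (step (predC D) a) => //=; first by rewrite negbK.
by move=> k k' kk' neD; apply: cutD kk' _; apply: contraNneq neD => ->.
Qed.

(** * Rows supported on an interval *)

(** The vanishing minors carry the ratio from a column to its neighbour as long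
    as the entries are nonzero; once the entries vanish, they stay zero when
    moving away from [k], so both rows have the same interval as support. *)
Lemma gapless_proportional (F : fieldType) (n : nat) (x y : 'rV[F]_n)
    (k : 'I_n) :
    gapless x -> gapless y -> null_connected x y -> x 0 k != 0 -> y 0 k != 0 ->
  y = (y 0 k / x 0 k) *: x.
Proof.
move=> gx gy /null_connectedP nc xk yk; set c := y 0 k / x 0 k.
have propk : y 0 k = c * x 0 k by rewrite divfK.
have step (j j' : 'I_n) : x 0 j * y 0 j' = x 0 j' * y 0 j ->
    (j = k \/ (k < j < j')%N \/ (j' < j < k)%N) ->
    y 0 j = c * x 0 j -> y 0 j' = c * x 0 j'.
  move=> minor pos e; have [xj | xj] := eqVneq (x 0 j) 0; last first.
    by apply: (mulfI xj); rewrite minor e mulrCA [RHS]mulrCA [x 0 j' * _]mulrC.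
  have yj : y 0 j = 0 by rewrite e xj mulr0.
  have outside z : gapless z -> z 0 k != 0 -> z 0 j = 0 -> z 0 j' = 0.
    move=> gz zk zj; case: pos => [jk | [] /andP[lt1 lt2]].
    - by rewrite -jk zj eqxx in zk.
    - by case: (gz k j j' lt1 lt2 zj) => // zk0; rewrite zk0 eqxx in zk.
    - by case: (gz j' j k lt1 lt2 zj) => // zk0; rewrite zk0 eqxx in zk.
  by rewrite !outside ?mulr0.
(* Outwards from k, by induction on the distance d to k. *)
have right d (j : 'I_n) : j = (k + d)%N :> nat -> y 0 j = c * x 0 j.
  elim: d j => [|d IH] j jd.
    by have -> : j = k by apply/val_inj; rewrite /= jd addn0.
  have lt_kd : (k + d < n)%N.
    by apply: ltn_trans (ltn_ord j); rewrite jd addnS.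
  apply: (step (Ordinal lt_kd)); last exact: IH.
    by apply: nc; rewrite /= jd addnS.
  case: d {IH} jd lt_kd => [|d] jd lt_kd.
    by left; apply/val_inj; rewrite /= addn0.
  by right; left; rewrite /= jd !addnS !ltnS leq_addr leqnn.
have left d (j : 'I_n) : k = (j + d)%N :> nat -> y 0 j = c * x 0 j.
  elim: d j => [|d IH] j jd.
    by have -> : j = k by apply/val_inj; rewrite /= jd addn0.
  have lt_j1 : (j.+1 < n)%N.
    by apply: leq_ltn_trans (ltn_ord k); rewrite jd addnS ltnS leq_addr.
  apply: (step (Ordinal lt_j1)); last by apply: IH; rewrite /= jd addnS.
    by have := nc j (Ordinal lt_j1) erefl => <-.
  case: d {IH} jd => [|d] jd.
    by left; apply/val_inj; rewrite /= jd addn1.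
  by right; right; rewrite /= jd ltnSn addnS addnS !ltnS leq_addr.
apply/rowP => j; rewrite !mxE.
have [kj | jk] := leqP k j.
  by apply: (right (j - k)%N); rewrite subnKC.
by apply: (left (k - j)%N); rewrite subnKC // ltnW.
Qed.

Lemma unitmx_row_not_proportional (F : fieldType) (n : nat) (A : 'M[F]_n)
    (i j : 'I_n) (c : F) :
  A \in unitmx -> i != j -> row j A <> c *: row i A.
Proof.
move=> uA ne e.
have : (delta_mx 0 j - c *: delta_mx 0 i : 'rV_n) *m A = 0.
  by rewrite mulmxBl -scalemxAl -!rowE e subrr.
move/(congr1 (mulmx^~ (invmx A))); rewrite mulmxK // mul0mx.
move/rowP/(_ j); rewrite !mxE !eqxx /= eq_sym (negbTE ne) mulr0 subr0.
by move/eqP; rewrite oner_eq0.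
Qed.

Lemma unitmx_transversal (F : fieldType) (n : nat) (A : 'M[F]_n) :
  A \in unitmx -> exists s : 'S_n, forall k, A (s k) k != 0.
Proof.
rewrite unitmxE unitfE => dA.
have [s nzs | all0] := pickP (fun s : 'S_n => \prod_i A i (s i) != 0).
  exists s^-1%g => k; have /prodf_neq0/(_ (s^-1%g k) isT) := nzs.
  by rewrite permKV.
case/eqP: dA; rewrite /determinant big1 // => s _.
by have /negbFE/eqP -> := all0 s; rewrite mulr0.
Qed.

(** Entry [k] of the second row is nonzero because the vanishing minor on the
    columns [k], [k'] equates a product containing it to a product of two
    diagonal entries; the two rows are then proportional. *)
Lemma gapless_transversal (F : fieldType) (n : nat) (B : 'M[F]_n) (s : 'S_n) :
    B \in unitmx -> (forall i, gapless (row i B)) ->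
    (forall k, B (s k) k != 0) ->
  forall k k' : 'I_n, k' = k.+1 :> nat ->
    ~~ null_connected (row (s k) B) (row (s k') B).
Proof.
move=> uB gB sB k k' kk'; apply/negP => nc.
have nes : s k != s k'.
  by rewrite (inj_eq perm_inj) -val_eqE /= kk' neq_ltn ltnSn.
have yk : row (s k') B 0 k != 0.
  have /null_connectedP/(_ k k' kk') minor := nc.
  have : row (s k) B 0 k * row (s k') B 0 k' != 0 by rewrite !mxE mulf_neq0.
  by rewrite minor mulf_eq0 negb_or => /andP[].
apply: (unitmx_row_not_proportional uB nes).
by apply: (gapless_proportional (k := k)) => //; rewrite mxE.
Qed.

(** * Orderings and Hamiltonian paths *)

Lemma hamiltonian_path_perm (n : nat) (e : rel 'I_n) (s : 'S_n) :
    (forall i j : 'I_n, j = i.+1 :> nat -> e (s i) (s j)) ->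
  hamiltonian_path e [seq s i | i <- enum 'I_n].
Proof.
move=> es; apply/and3P; split.
- case: n e s es => [|n] e s es; first by rewrite (size0nil (size_enum_ord 0)).
  rewrite sorted_map; apply/(sortedP ord0) => i; rewrite size_enum_ord => lt_i.
  by apply: es; rewrite !nth_enum_ord // ltnW.
- by rewrite map_inj_uniq ?enum_uniq //; apply: perm_inj.
- by apply/forallP => x; rewrite -[x](permKV s) map_f ?mem_enum.
Qed.

Theorem proposition1p5 (F : fieldType) (n : nat) (A : 'M[F]_n)
    (hA : A \in unitmx) :
  (exists s : 'S_n, forall i j : 'I_n, j = i.+1 :> nat ->
     ~~ null_connected (row i (row_perm s A)) (row j (row_perm s A)))
  /\ (exists p : seq 'I_n, hamiltonian_path (two_row_graph A) p).
Proof.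
have [B [uB gB ncB]] := exists_gapless hA.
have [s sB] := unitmx_transversal uB.
have sA (i j : 'I_n) : j = i.+1 :> nat ->
    ~~ null_connected (row (s i) A) (row (s j) A).
  by move=> ij; apply: contra (gapless_transversal uB gB sB ij); apply: ncB.
split.
  exists s => i j ij.
  have rowE k : row k (row_perm s A) = row (s k) A.
    by apply/rowP => l; rewrite !mxE.
  by rewrite !rowE sA.
exists [seq s i | i <- enum 'I_n]; apply: hamiltonian_path_perm => i j ij.
by rewrite two_row_graphE sA.
Qed.
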